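(* Let $n\ge 1$ and let $H_n$ be the graph defined in the context. Then (i) $$I(H_n;x)=\prod_{s=1}^{\lfloor (n+1)/2\rfloor}\left(1+4x+x^2+2x\cos\frac{2s\pi}{n+2}\right);$$ (ii) $I(H_n;x)$ is symmetric; (iii) $I(H_n;x)$ has only real zeros, and is therefore log-concave and unimodal.
   Context: For a finite simple graph $H$, the independence polynomial is $I(H;x)=\sum_{k\ge 0} i_k(H)x^k$, where $i_k(H)$ is the number of independent sets (sets of pairwise non-adjacent vertices) of size $k$ in $H$ ($i_0(H)=1$). The graph $H_n$ is defined as follows: start with the path $v_1v_2\cdots v_n$; for each $i=1,\dots,\lfloor n/2\rfloor$ add two new vertices, each adjacent exactly to $v_{2i-1}$ and $v_{2i}$; if $n$ is odd, additionally add two new vertices each adjacent only to $v_n$. (So $I(H_1;x)=1+3x+x^2$, $I(H_2;x)=1+4x+x^2$.) A polynomial $\sum_{k=0}^d a_kx^k$ is symmetric if $a_k=a_{d-k}$ for all $k$, log-concave if $a_k^2\ge a_{k-1}a_{k+1}$ for $1\le k\le d-1$, and unimodal if $a_0\le\cdots\le a_j\ge a_{j+1}\ge\cdots\ge a_d$ for some $j$. *)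

(* Defs.v *)
From mathcomp Require Import all_boot all_order all_algebra.
From mathcomp Require Import reals trigo complex.

Set Implicit Arguments.
Unset Strict Implicit.
Unset Printing Implicit Defensive.

Import GRing.Theory Num.Theory.
Local Open Scope ring_scope.

Record sgraph := SGraph {
  svertex :> finType;
  sedge : rel svertex;
  sedge_sym : symmetric sedge;
  sedge_irrefl : irreflexive sedge }.

Definition independent (G : sgraph) (A : {set G}) : bool :=
  [forall x in A, forall y in A, ~~ sedge x y].

Definition indep_num (G : sgraph) (k : nat) : nat :=
  #|[set A : {set G} | independent A & #|A| == k]|.

(* There are no independent sets with more than #|G| elements, so the sum
   over all k >= 0 stops at #|G|. *)
Definition indep_poly (R : nzRingType) (G : sgraph) : {poly R} :=
  \sum_(k < #|G|.+1) (indep_num G k)%:R *: 'X^k.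

(* Vertices are 0-based: [inl j] is v_(j+1), and [inr (i, b)], b : bool, are
   the two new vertices of block i+1.  There are uphalf n = ceil(n/2) blocks;
   block i+1 is attached to v_(2i+1) and v_(2i+2).  When n is odd, v_(2i+2)
   does not exist for the last block i = (n-1)/2, so that its two new vertices
   are adjacent to v_n only. *)
Definition Hgraph_vertex (n : nat) : finType :=
  ('I_n + 'I_(uphalf n) * bool)%type.

Definition Hgraph_edge (n : nat) : rel (Hgraph_vertex n) := fun u v =>
  match u, v with
  | inl j, inl k => (k == j.+1 :> nat) || (j == k.+1 :> nat)
  | inl j, inr (i, _) | inr (i, _), inl j =>
      (j == i.*2 :> nat) || (j == i.*2.+1 :> nat)
  | inr _, inr _ => false
  end.

Lemma Hgraph_edge_sym n : symmetric (@Hgraph_edge n).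
Proof. by move=> [j|[i b]] [k|[l c]] //=; rewrite orbC. Qed.

Lemma Hgraph_edge_irrefl n : irreflexive (@Hgraph_edge n).
Proof. by move=> [j|[i b]] //=; rewrite orbb ltn_eqF. Qed.

Definition Hgraph (n : nat) : sgraph :=
  SGraph (@Hgraph_edge_sym n) (@Hgraph_edge_irrefl n).

(* In the three predicates below, d = (size p).-1 is the degree of p. *)
Definition symmetric_poly (R : nzRingType) (p : {poly R}) : Prop :=
  forall k : nat, (k <= (size p).-1)%N -> p`_k = p`_((size p).-1 - k).

Definition log_concave_poly (R : numDomainType) (p : {poly R}) : Prop :=
  forall k : nat, (1 <= k)%N -> (k < (size p).-1)%N ->
    p`_(k.-1) * p`_(k.+1) <= p`_k ^+ 2.

Definition unimodal_poly (R : numDomainType) (p : {poly R}) : Prop :=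
  exists2 j : nat, (j <= (size p).-1)%N &
    (forall k : nat, (k < j)%N -> p`_k <= p`_(k.+1)) /\
    (forall k : nat, (j <= k)%N -> (k < (size p).-1)%N -> p`_(k.+1) <= p`_k).

Definition only_real_zeros (R : rcfType) (p : {poly R}) : Prop :=
  forall z : R[i], root (map_poly (real_complex R) p) z -> complex.Im z = 0.

(* Main.v *)
(** Deleting [v_n] (and, for odd [n], the two pendant vertices which this isolates)
    gives [P_n = P_(n-1) + x P_(n-2)] for [n] even and
    [P_n = (1 + x)^2 P_(n-1) + x P_(n-2)] for [n] odd.  Hence
    [P_n(x) = x^m g_n((1 + x)^2 / x)] with [m = ceil(n/2)] and [g_n] monic of degree [m].
    At [z = - 4 cos^2 t] the recurrence for [g_n] becomes the addition formula of the
    sine, so [g_n] vanishes when [sin ((n + 2) t) = 0], i.e. at [t = s pi / (n + 2)];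
    these are [m] distinct roots, and [4 cos^2 t = 2 + 2 cos (2 t)] gives the product.
    Each factor is [1 + b x + x^2] with [b >= 2], hence [(1 + r x) (1 + r' x)] with
    [r, r' > 0], and the remaining claims are stable under such products. *)
Require Import Defs.
From mathcomp Require Import all_boot all_order all_algebra.
From mathcomp Require Import reals trigo complex.
From mathcomp Require Import ring lra zify.

Set Implicit Arguments.
Unset Strict Implicit.
Unset Printing Implicit Defensive.

Import Order.TTheory GRing.Theory Num.Theory.
Local Open Scope ring_scope.

(** * Independence polynomials of induced subgraphs *)

(** Induced subgraphs are vertex sets [S] of a fixed [G], so deleting vertices does not change the
    vertex type. *)
Definition indep_poly_in (R : nzRingType) (G : sgraph) (S : {set G}) :
    {poly R} :=
  \sum_(A : {set G} | (A \subset S) && independent A) 'X^#|A|.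

Lemma indep_polyE (R : nzRingType) (G : sgraph) :
  indep_poly R G = indep_poly_in R [set: G].
Proof.
rewrite /indep_poly /indep_poly_in.
rewrite (partition_big (fun A : {set G} => inord #|A| : 'I_#|G|.+1) predT) //=.
apply: eq_bigr => k _.
rewrite scaler_nat -sumr_const.
apply: eq_big => [A|A]; rewrite inE.
  by rewrite subsetT -val_eqE /= inordK // ltnS max_card.
by case/andP=> _ /eqP ->.
Qed.

Lemma independent0 (G : sgraph) : independent (set0 : {set G}).
Proof. by apply/forall_inP => x; rewrite inE. Qed.

Lemma independentU1 (G : sgraph) (v : G) (A : {set G}) :
  independent (v |: A) = independent A && [forall u in A, ~~ sedge v u].
Proof.
apply/idP/andP => [indA|[indA /forall_inP nvA]].
  have ind x y : x \in v |: A -> y \in v |: A -> ~~ sedge x y.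
    by move=> xA yA; have /forall_inP/(_ _ xA)/forall_inP/(_ _ yA) := indA.
  split.
    by do 2![apply/forall_inP => ? ?]; apply: ind; rewrite setU1r.
  by apply/forall_inP => u uA; rewrite ind ?setU11 ?setU1r.
apply/forall_inP => x /setU1P[->|xA]; apply/forall_inP => y /setU1P[->|yA].
- by rewrite sedge_irrefl.
- exact: nvA.
- by rewrite sedge_sym nvA.
- by have /forall_inP/(_ _ xA)/forall_inP/(_ _ yA) := indA.
Qed.

(** Independent sets containing [v] correspond, by removing [v], to independent sets that avoid [v]
    and its neighbours. *)
Lemma indep_poly_in_delete (R : nzRingType) (G : sgraph) (S : {set G}) (v : G) :
  v \in S ->
  indep_poly_in R S = indep_poly_in R (S :\ v)
    + 'X * indep_poly_in R [set u in S :\ v | ~~ sedge v u].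
Proof.
move=> vS; rewrite /indep_poly_in (bigID (fun A : {set G} => v \in A)) /= addrC.
congr (_ + _).
  by apply: eq_bigl => A; rewrite subsetD1 andbAC.
rewrite (reindex_onto (fun B => v |: B) (fun A => A :\ v)) /=; last first.
  by move=> A /andP[_ vA]; rewrite setD1K.
rewrite big_distrr /=; apply: eq_big => [B|B /andP[_ /eqP eqB]]; last first.
  by rewrite cardsU1 -eqB !inE eqxx /= add1n exprS.
rewrite setU11 andbT independentU1.
have [vB|vB] := boolP (v \in B).
  rewrite (_ : (_ == B) = false); last first.
    by apply/eqP => /setP/(_ v); rewrite !inE eqxx vB.
  rewrite andbF; apply/esym/negbTE/negP => /andP[/subsetP/(_ v vB)].
  by rewrite !inE eqxx.
rewrite setU1K // eqxx andbT subUset sub1set vS /= andbCA andbC.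
congr (_ && _); apply/andP/subsetP => [[BS /forall_inP nvB] u uB|BS].
  rewrite !inE nvB // (subsetP BS) // !andbT.
  by apply: contraNneq vB => <-.
split; first by apply/subsetP => u /BS; rewrite !inE => /andP[/andP[]].
by apply/forall_inP => u /BS; rewrite inE => /andP[].
Qed.

Lemma indep_poly_in_isolated (R : nzRingType) (G : sgraph) (S : {set G})
    (v : G) :
  v \in S -> (forall u, u \in S -> ~~ sedge v u) ->
  indep_poly_in R S = (1 + 'X) * indep_poly_in R (S :\ v).
Proof.
move=> vS nvS; rewrite (indep_poly_in_delete _ vS) mulrDl mul1r.
congr (_ + 'X * indep_poly_in R _).
by apply/setP => u; rewrite inE; case: setD1P => // -[_ /nvS ->].
Qed.

Lemma indep_poly_in0 (R : nzRingType) (G : sgraph) :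
  indep_poly_in R (set0 : {set G}) = 1.
Proof.
rewrite /indep_poly_in (big_pred1 set0) ?cards0 ?expr0 // => A.
by rewrite subset0 andb_idr // => /eqP ->; exact: independent0.
Qed.

(** * The recurrence for [H_n] *)

(* [H_n] as an induced subgraph of [H_N], for [n <= N]. *)
Definition Hgraph_prefix (N n : nat) : {set Hgraph N} :=
  [set u : Hgraph_vertex N |
    match u with inl j => (j < n)%N | inr (i, _) => (i < uphalf n)%N end].

Lemma Hgraph_prefixT (n : nat) : Hgraph_prefix n n = [set: Hgraph n].
Proof. by apply/setP => -[j|[i b]]; rewrite !inE ltn_ord. Qed.

Lemma indep_poly_Hprefix0 (R : nzRingType) (N : nat) :
  indep_poly_in R (Hgraph_prefix N 0) = 1.
Proof.
rewrite -(indep_poly_in0 R (Hgraph N)); congr indep_poly_in.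
by apply/setP => -[j|[i b]]; rewrite !inE.
Qed.

(* For [n = 0] the truncation [n.-1 = 0] is harmless: [P_(-1) = P_0 = 1]. *)
Lemma indep_poly_HprefixS (R : nzRingType) (N n : nat) :
  (n < N)%N ->
  indep_poly_in R (Hgraph_prefix N n.+1) =
    (if odd n then 1 else (1 + 'X) ^+ 2) * indep_poly_in R (Hgraph_prefix N n)
    + 'X * indep_poly_in R (Hgraph_prefix N n.-1).
Proof.
move=> lt_nN; pose v : Hgraph N := inl (Ordinal lt_nN).
have eqv j : (inl j == v) = (j == n :> nat) by [].
rewrite (@indep_poly_in_delete R (Hgraph N) _ v); last by rewrite inE /=; lia.
congr (_ + _ * _); last first.
  (* For either parity, the neighbours of [v] in the prefix are its predecessor on the path, if any,
     and the two new vertices of the last block. *)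
  congr indep_poly_in; apply/setP => -[j|[i b]]; rewrite !inE ?eqv /=; lia.
case: ifPn => [n_odd|n_even].
  rewrite mul1r; congr indep_poly_in.
  by apply/setP => -[j|[i b]]; rewrite !inE ?eqv /=; lia.
have lt_n2 : (n./2 < uphalf N)%N by lia.
(* The two new vertices of the last block: for even [n] their only neighbour in the prefix is
   [v]. *)
pose w b : Hgraph N := inr (Ordinal lt_n2, b).
have eqw i b c : (inr (i, b) == w c) = (i == n./2 :> nat) && (b == c) by [].
rewrite (@indep_poly_in_isolated R (Hgraph N) _ (w true)); first last.
- by case=> [j|[i b]]; rewrite !inE ?eqv /=; lia.
- by rewrite !inE /=; lia.
rewrite (@indep_poly_in_isolated R (Hgraph N) _ (w false)); first last.
- by case=> [j|[i b]]; rewrite !inE ?eqv /=; lia.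
- by rewrite !inE eqw /=; lia.
rewrite mulrA -expr2; congr (_ * _); congr indep_poly_in.
apply/setP => -[j|[i b]]; rewrite !inE ?eqv ?eqw /=; first by lia.
by case: b; lia.
Qed.

(** * The reduced polynomials and their trigonometric roots *)

(** The difference vanishes at more positive integers than its degree allows. This permits the
    substitution of [(1 + x)^2 / x], which requires [x != 0]. *)
Lemma poly_eq_neq0 (R : numDomainType) (p q : {poly R}) :
  (forall x, x != 0 -> p.[x] = q.[x]) -> p = q.
Proof.
move=> eqpq; apply/eqP; rewrite -subr_eq0; apply/eqP.
pose rs := [seq k.+1%:R : R | k <- iota 0 (size (p - q))].
apply: (@roots_geq_poly_eq0 _ _ rs).
- apply/allP => _ /mapP[k _ ->].
  by rewrite rootE !hornerE eqpq ?subrr // pnatr_eq0.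
- rewrite map_inj_uniq ?iota_uniq // => i j /eqP.
  by rewrite eqr_nat => /eqP[].
- by rewrite size_map size_iota.
Qed.

(* The recurrence of [indep_poly_HprefixS] in the variable [z = (1 + x)^2 / x]. *)
Fixpoint zpoly (R : nzRingType) (n : nat) : {poly R} :=
  match n with
  | 0 => 1
  | m.+1 => (if odd m then 1 else 'X) * zpoly R m + zpoly R m.-1
  end.

Lemma zpoly_monic_size (R : nzRingType) (n : nat) :
  (zpoly R n \is monic) && (size (zpoly R n) == (uphalf n).+1).
Proof.
elim/ltn_ind: n => -[|n] IHn; first by rewrite monic1 size_poly1.
have /andP[mon_n /eqP size_n] := IHn n (ltnSn n).
have /andP[_ /eqP size_n1] := IHn n.-1 ltac:(lia).
rewrite /= -/(zpoly _ _); case: ifPn => [n_odd|n_even].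
  have lt_size : (size (zpoly R n.-1) < size (zpoly R n))%N.
    by rewrite size_n size_n1; lia.
  rewrite mul1r monicE lead_coefDl // size_polyDl // -monicE mon_n size_n /=.
  by apply/eqP; lia.
have zn_neq0 : zpoly R n != 0 by rewrite -size_poly_eq0 size_n.
have lt_size : (size (zpoly R n.-1) < size ('X * zpoly R n)%R)%N.
  by rewrite -commr_polyX size_mulX // size_n size_n1; lia.
rewrite monicE lead_coefDl // size_polyDl // -commr_polyX lead_coefMX -monicE.
by rewrite mon_n size_mulX // size_n /=; apply/eqP; lia.
Qed.

(** The parity-dependent factor absorbs the alternation between [1] and ['X] in the recurrence: both
    parities reduce to [sin (a + t) = 2 cos t sin a - sin (a - t)]. *)
Lemma zpoly_cos (R : realType) (n : nat) (t : R) :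
  (zpoly R n).[- (4 * cos t ^+ 2)] *
    (if odd n then sin t else 2 * cos t * sin t) =
  (-1) ^+ uphalf n * sin (n.+2%:R * t).
Proof.
suff [] : (zpoly R n).[- (4 * cos t ^+ 2)] *
    (if odd n then sin t else 2 * cos t * sin t) =
    (-1) ^+ uphalf n * sin (n.+2%:R * t) /\
  (zpoly R n.+1).[- (4 * cos t ^+ 2)] *
    (if odd n.+1 then sin t else 2 * cos t * sin t) =
  (-1) ^+ uphalf n.+1 * sin (n.+3%:R * t) by [].
have sin3 (a : R) : sin (a + t) = 2 * cos t * sin a - sin (a - t).
  by rewrite sinD sinB; ring.
elim: n => [|n [IHn IHn1]].
  rewrite /= !mulr1 !(hornerD, hornerX, hornerC).
  have -> : 2 * t = t + t by ring.
  have -> : 3 * t = t + t + t by ring.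
  by rewrite (sin3 (t + t)) addrK sinD; split; ring.
split=> //; rewrite [zpoly R n.+2]/(_ * zpoly R n.+1 + zpoly R n).
have -> : n.+4%:R * t = n.+3%:R * t + t by rewrite -[n.+4]addn1 natrD; ring.
have e2 : n.+2%:R * t = n.+3%:R * t - t by rewrite -[n.+3]addn1 natrD; ring.
rewrite sin3 -e2.
move: IHn IHn1.
set a := (zpoly R n).[_]; set b := (zpoly R n.+1).[_].
set s2 := sin (_.+2%:R * t); set s3 := sin (_.+3%:R * t).
rewrite hornerD hornerM -/a -/b; have := uphalf_half n; rewrite /=.
case: ifPn => [n_odd|n_even] /= -> IHn IHn1; rewrite ?hornerX ?hornerC.
  transitivity (- (2 * cos t) * (b * (2 * cos t * sin t)) + a * sin t).
    by ring.
  by rewrite IHn IHn1 add1n !exprS; ring.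
transitivity (2 * cos t * (b * sin t) + a * (2 * cos t * sin t)); first by ring.
by rewrite IHn IHn1 add0n !exprS; ring.
Qed.

Lemma zpoly_prod (R : realType) (n : nat) :
  zpoly R n = \prod_(1 <= s < ((n + 1) %/ 2).+1)
    ('X - (- (2 + 2 * cos (2 * s%:R * pi / (n + 2)%:R)))%:P).
Proof.
pose a (s : nat) : R := 2 * s%:R * pi / (n + 2)%:R.
pose r s := - (2 + 2 * cos (a s)).
have n2_gt0 : (0 : R) < (n + 2)%:R by rewrite ltr0n addn2.
(* This range makes [cos] injective on the angles [a s], and makes [sin] and [cos] nonzero at the
   half angles. *)
have a_bnd s : (0 < s < ((n + 1) %/ 2).+1)%N -> 0 < a s < pi.
  case/andP=> s_gt0 s_lt; have lt_s : 2 * s%:R < (n + 2)%:R :> R.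
    by rewrite -natrM ltr_nat; lia.
  rewrite /a ltr_pdivrMr // [pi * _]mulrC ltr_pM2r ?pi_gt0 // lt_s andbT.
  by rewrite divr_gt0 // !mulr_gt0 ?pi_gt0 // ltr0n.
have /andP[/monicP lead_z /eqP size_z] := zpoly_monic_size R n.
rewrite -(big_map r predT (fun z => 'X - z%:P)).
rewrite [LHS](@all_roots_prod_XsubC _ _
  (map r (index_iota 1 ((n + 1) %/ 2).+1))).
- by rewrite lead_z scale1r.
- by rewrite size_z size_map size_iota; lia.
- apply/allP => _ /mapP[s s_in ->].
  rewrite mem_index_iota in s_in; have /andP[a_gt0 a_lt] := a_bnd s s_in.
  have sin_gt0 : 0 < sin (a s / 2) by apply: sin_gt0_pi; apply/andP; split; lra.
  have cos_gt0 : 0 < cos (a s / 2).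
    by apply: cos_gt0_pihalf; apply/andP; split; lra.
  have -> : r s = - (4 * cos (a s / 2) ^+ 2).
    rewrite /r [in cos (a s)](_ : a s = (a s / 2) *+ 2); last by field.
    by rewrite cos_mulr2n; ring.
  have := zpoly_cos n (a s / 2).
  have -> : n.+2%:R * (a s / 2) = 0 + pi *+ s.
    by rewrite /a add0r -[pi *+ s]mulr_natr addn2; field;
      rewrite -natrD pnatr_eq0.
  have -> : sin (0 + pi *+ s) = 0 :> R.
    elim: (s) => [|k IHk]; first by rewrite mulr0n addr0 sin0.
    by rewrite mulrSr addrA sinDpi IHk oppr0.
  rewrite mulr0 => /eqP; rewrite mulf_eq0 => /orP[//|].
  by case: ifP => _; rewrite gt_eqF // !mulr_gt0.
rewrite uniq_rootsE map_inj_in_uniq ?iota_uniq // => s s'.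
rewrite !mem_index_iota => /a_bnd/andP[a0 a1] /a_bnd/andP[b0 b1] /oppr_inj/addrI.
have two_neq0 : (2 : R) != 0 by rewrite pnatr_eq0.
move/(mulfI two_neq0)/cos_inj; rewrite !in_itv /= !ltW // => /(_ isT isT).
have c_neq0 : pi / (n + 2)%:R != 0 :> R.
  by rewrite gt_eqF ?divr_gt0 ?pi_gt0.
rewrite /a -!mulrA => /(mulfI two_neq0) /(mulIf c_neq0) /eqP.
by rewrite eqr_nat => /eqP.
Qed.

(** * The product formula *)

Lemma indep_poly_Hprefix_horner (R : fieldType) (N n : nat) (x : R) :
  x != 0 -> (n <= N)%N ->
  (indep_poly_in R (Hgraph_prefix N n)).[x] =
    x ^+ uphalf n * (zpoly R n).[(1 + x) ^+ 2 / x].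
Proof.
move=> x_neq0; elim/ltn_ind: n => -[|n] IHn le_nN.
  by rewrite indep_poly_Hprefix0 /= !hornerC mulr1.
rewrite indep_poly_HprefixS // hornerD !hornerM hornerX.
rewrite (IHn n) ?(IHn n.-1); try lia.
rewrite [zpoly R n.+1]/(_ * zpoly R n + zpoly R n.-1) hornerD hornerM.
(* The extra power of [x] comes from the last summand's own factor [x] for odd [n]; for even [n] it
   also comes from [(1 + x)^2 = x z]. *)
case: ifPn => [n_odd|n_even].
  have -> : uphalf n.+1 = (uphalf n.-1).+1 by lia.
  have -> : uphalf n = (uphalf n.-1).+1 by lia.
  by rewrite !hornerC exprS; ring.
have -> : uphalf n.+1 = (uphalf n).+1 by lia.
have -> : uphalf n.-1 = uphalf n by lia.
rewrite horner_exp hornerD !hornerX hornerC [x ^+ _.+1]exprS.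
by field.
Qed.

Lemma indep_poly_Hgraph_prod (R : realType) (n : nat) :
  indep_poly R (Hgraph n) =
    \prod_(1 <= s < ((n + 1) %/ 2).+1)
      (1 + 4%:R *: 'X + 'X^2
         + (2%:R * cos (2%:R * s%:R * pi / (n + 2)%:R)) *: 'X).
Proof.
apply: poly_eq_neq0 => x x_neq0.
rewrite indep_polyE -Hgraph_prefixT indep_poly_Hprefix_horner //.
rewrite zpoly_prod !horner_prod.
(* Distributes [x ^+ uphalf n] as one factor [x] to each root factor, which clears its
   denominator. *)
have -> : uphalf n = (\sum_(1 <= s < ((n + 1) %/ 2).+1) 1)%N.
  by rewrite sum_nat_const_nat; lia.
rewrite -prodrXr -big_split /=; apply: eq_bigr => s _.
rewrite !(hornerD, hornerN, hornerX, hornerC, hornerZ, hornerXn) expr1.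
by field.
Qed.

(** * Real zeros, log-concavity and unimodality from linear factors *)

Lemma only_real_zeros_prod (R : rcfType) (rs : seq R) :
  all (> 0) rs -> only_real_zeros (\prod_(r <- rs) (1 + r *: 'X)).
Proof.
move=> /allP rs_gt0 z; rewrite rmorph_prod /= => /rootP.
rewrite horner_prod => /eqP; rewrite prodf_seq_eq0 => /hasP[r /rs_gt0 r_gt0].
rewrite rmorphD rmorph1 /= map_polyZ map_polyX.
rewrite !(hornerD, hornerZ, hornerX, hornerC) /= => /eqP.
case: z => u v; simpc => -[_ /eqP].
by rewrite mulf_eq0 gt_eqF // => /eqP.
Qed.

(* Log-concavity without internal zeros, which unlike plain log-concavity is stable
   under multiplication by [1 + r X]. *)
Definition tp2_poly (R : numDomainType) (p : {poly R}) : Prop :=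
  (forall k, 0 <= p`_k) /\
  (forall i j, (i <= j)%N -> p`_i * p`_j.+1 <= p`_i.+1 * p`_j).

Lemma tp2_poly1 (R : numDomainType) : tp2_poly (1 : {poly R}).
Proof.
split=> [k|i j _]; first by rewrite coef1 ler0n.
by rewrite !coef1 /= mul0r mulr0.
Qed.

Lemma tp2_poly_mul (R : realDomainType) (r : R) (p : {poly R}) :
  0 <= r -> tp2_poly p -> tp2_poly ((1 + r *: 'X) * p).
Proof.
move=> r_ge0 [p_ge0 tp2p].
have coefS k : ((1 + r *: 'X) * p)`_k.+1 = p`_k.+1 + r * p`_k.
  by rewrite mulrDl mul1r coefD -scalerAl coefZ coefXM.
have coef0 : ((1 + r *: 'X) * p)`_0 = p`_0.
  by rewrite mulrDl mul1r coefD -scalerAl coefZ coefXM mulr0 addr0.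
split=> [[|k]|[|i] [|j] //].
- by rewrite coef0.
- by rewrite coefS addr_ge0 // mulr_ge0.
- by move=> _; rewrite mulrC.
- move=> _; rewrite coef0 !coefS.
  have := tp2p 0 j.+1 isT; have := mulr_ge0 r_ge0 (mulr_ge0 (p_ge0 1) (p_ge0 j)).
  have := mulr_ge0 (mulr_ge0 r_ge0 r_ge0) (mulr_ge0 (p_ge0 0) (p_ge0 j)).
  nra.
- rewrite ltnS => le_ij; rewrite !coefS.
  have h0 := tp2p i.+1 j.+1 le_ij.
  have h2 := ler_wpM2l (mulr_ge0 r_ge0 r_ge0) (tp2p i j le_ij).
  (* The powers of [r] are compared separately. In degree one [p_(i+1) p_(j+1)] cancels, and the
     rest follows by passing through that product, or is an equality if [i = j]. *)
  have h1 : r * (p`_i * p`_j.+2) <= r * (p`_i.+2 * p`_j).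
    rewrite ler_wpM2l //; move: le_ij; rewrite leq_eqVlt => /orP[/eqP ->|lt_ij].
      by rewrite mulrC.
    by apply: le_trans (tp2p i j.+1 _) (tp2p i.+1 j lt_ij); rewrite leqW // ltnW.
  have := lerD (lerD h0 h1) h2.
  rewrite -subr_ge0 => h; rewrite -subr_ge0; apply: le_trans h _.
  by rewrite le_eqVlt; apply/orP; left; apply/eqP; ring.
Qed.

Lemma tp2_poly_prod (R : realDomainType) (rs : seq R) :
  all (> 0) rs -> tp2_poly (\prod_(r <- rs) (1 + r *: 'X)).
Proof.
elim: rs => [_|r rs IHrs /= /andP[/ltW r_ge0 /IHrs tp2p]].
  by rewrite big_nil; exact: tp2_poly1.
by rewrite big_cons; exact: tp2_poly_mul.
Qed.

Lemma tp2_log_concave (R : numDomainType) (p : {poly R}) :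
  tp2_poly p -> log_concave_poly p.
Proof. by move=> [_ tp2p] [//|k] _ _; rewrite expr2 tp2p. Qed.

(** After a first descent at [j], [p_j p_(k+1) <= p_(j+1) p_k <= p_j p_k], and [p_j > 0] cancels. *)
Lemma tp2_unimodal (R : realDomainType) (p : {poly R}) :
  tp2_poly p -> 0 < p`_0 -> unimodal_poly p.
Proof.
move=> [p_ge0 tp2p] p0_gt0; set d := (size p).-1.
have ex_descent : exists k, (d <= k)%N || (p`_k.+1 <= p`_k).
  by exists d; rewrite leqnn.
case: (ex_minnP ex_descent) => j j_descent j_min.
have incr k : (k < j)%N -> p`_k < p`_k.+1.
  by rewrite ltnNge ltNge; apply: contra => le_p; apply: j_min; rewrite le_p orbT.
have pj_gt0 : 0 < p`_j.
  by case: j incr {j_descent j_min} => // j /(_ j (leqnn _)); exact: le_lt_trans.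
exists j; first by apply: j_min; rewrite leqnn.
split=> [k /incr /ltW //|k le_jk lt_kd].
have {}j_descent : p`_j.+1 <= p`_j.
  by case/orP: j_descent => // le_dj;
    have := leq_trans le_dj le_jk; rewrite leqNgt lt_kd.
rewrite -(ler_pM2l pj_gt0); apply: le_trans (tp2p _ _ le_jk) _.
exact: ler_wpM2r.
Qed.

(** * Symmetry *)

(** Here [d] only bounds the degree, so products need no control of leading coefficients; a nonzero
    constant coefficient later forces [d] to be the degree. *)
Definition palindromic (R : nzRingType) (d : nat) (p : {poly R}) : Prop :=
  (size p <= d.+1)%N /\ forall i j, (i + j)%N = d -> p`_i = p`_j.

Lemma palindromic_mul (R : nzRingType) (d : nat) (b : R) (p : {poly R}) :
  palindromic d p -> palindromic d.+2 ((1 + b *: 'X + 'X^2) * p).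
Proof.
move=> [size_p sym_p].
have p_big k : (d < k)%N -> p`_k = 0.
  by move=> lt_dk; rewrite nth_default // (leq_trans size_p).
have coefE k : ((1 + b *: 'X + 'X^2) * p)`_k =
    p`_k + b * (if k is k'.+1 then p`_k' else 0) +
    (if k is k'.+2 then p`_k' else 0).
  rewrite !mulrDl mul1r -scalerAl !coefD coefZ coefXM coefXnM.
  by case: k => [|[|k]] //=; rewrite subn2.
split.
  apply/leq_sizeP => -[|[|k]] // lt_dk.
  by rewrite coefE !p_big ?mulr0 ?addr0 //; lia.
have wlog_le i j : (i <= j)%N -> (i + j)%N = d.+2 ->
    ((1 + b *: 'X + 'X^2) * p)`_i = ((1 + b *: 'X + 'X^2) * p)`_j.
  case: i j => [|[|i]] [|[|j]] //; rewrite !coefE => _ eq_ij.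
  - by rewrite (p_big j.+2) ?(p_big j.+1) ?mulr0 ?addr0 ?add0r;
      [apply: sym_p|..]; lia.
  - rewrite (p_big j.+2); last by lia.
    rewrite addr0 add0r addrC (sym_p 0%N j.+1) ?(sym_p 1%N j) //; lia.
  - rewrite (sym_p i j.+2) ?(sym_p i.+1 j.+1) ?(sym_p i.+2 j); try lia.
    by rewrite [RHS]addrC addrA [RHS]addrAC.
move=> i j eq_ij; have [le_ij|/ltnW le_ji] := leqP i j; first exact: wlog_le.
by apply/esym/wlog_le; rewrite // addnC.
Qed.

Lemma palindromic_prod (R : nzRingType) (I : Type) (s : seq I) (b : I -> R) :
  palindromic (size s).*2 (\prod_(i <- s) (1 + b i *: 'X + 'X^2)).
Proof.
elim: s => [|i s IHs]; last by rewrite big_cons; exact: palindromic_mul.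
by rewrite big_nil; split=> [|[|i] [|j]] //; rewrite size_poly1.
Qed.

Lemma palindromic_symmetric (R : nzRingType) (d : nat) (p : {poly R}) :
  p`_0 != 0 -> palindromic d p -> symmetric_poly p.
Proof.
move=> p0_neq0 [size_p sym_p] k le_k.
have lt_d : (d < size p)%N.
  rewrite ltnNge; apply: contra p0_neq0 => le_d.
  by rewrite (sym_p 0%N d) // nth_default.
by apply: sym_p; lia.
Qed.

(** * Splitting the quadratic factors, and the conclusion *)

Lemma quadratic_factor (R : rcfType) (b : R) :
  2 <= b -> exists r s : R, [/\ 0 < r, 0 < s &
    1 + b *: 'X + 'X^2 = (1 + r *: 'X) * (1 + s *: 'X) :> {poly R}].
Proof.
(* [q] is the root of the discriminant: [r] and [s] must have sum [b] and product [1]. *)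
move=> b_ge2; pose q := Num.sqrt (b ^+ 2 - 4).
have q2 : q ^+ 2 = b ^+ 2 - 4 by rewrite sqr_sqrtr //; nra.
have q_ge0 : 0 <= q by rewrite sqrtr_ge0.
have lt_qb : q < b by nra.
exists ((b + q) / 2), ((b - q) / 2); split; [lra|lra|].
have rs1 : (b + q) / 2 * ((b - q) / 2) = 1.
  have -> : (b + q) / 2 * ((b - q) / 2) = (b ^+ 2 - q ^+ 2) / 4 by field.
  by rewrite q2; field.
rewrite mulrDl mul1r mulrDr mulr1 -scalerAl -scalerAr scalerA rs1 scale1r.
rewrite -expr2 !addrA -[1 + _ *: 'X + _ *: 'X]addrA -scalerDl; congr (1 + _ *: _ + _).
by field.
Qed.

Lemma prod_linear_factors (R : rcfType) (I : Type) (s : seq I) (b : I -> R) :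
  (forall i, 2 <= b i) ->
  exists2 rs, all (> 0) rs &
    \prod_(i <- s) (1 + b i *: 'X + 'X^2) = \prod_(r <- rs) (1 + r *: 'X).
Proof.
move=> b_ge2; elim: s => [|i s [rs rs_gt0 IHs]].
  by exists [::]; rewrite ?big_nil.
have [r [t [r_gt0 t_gt0 eqrt]]] := quadratic_factor (b_ge2 i).
by exists [:: r, t & rs]; rewrite /= ?r_gt0 ?t_gt0 // !big_cons IHs eqrt mulrA.
Qed.

Theorem theorem3p14 (R : realType) (n : nat) (hn : (1 <= n)%N) :
  indep_poly R (Hgraph n) =
    \prod_(1 <= s < ((n + 1) %/ 2).+1)
      (1 + 4%:R *: 'X + 'X^2
         + (2%:R * cos (2%:R * s%:R * pi / (n + 2)%:R)) *: 'X)
  /\ symmetric_poly (indep_poly R (Hgraph n))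
  /\ only_real_zeros (indep_poly R (Hgraph n))
  /\ log_concave_poly (indep_poly R (Hgraph n))
  /\ unimodal_poly (indep_poly R (Hgraph n)).
Proof.
have prodE := indep_poly_Hgraph_prod R n; split=> //.
set p := indep_poly R (Hgraph n) in prodE *.
pose b (s : nat) : R := 4 + 2 * cos (2 * s%:R * pi / (n + 2)%:R).
have {}prodE : p = \prod_(s <- index_iota 1 ((n + 1) %/ 2).+1)
    (1 + b s *: 'X + 'X^2).
  rewrite prodE; apply: eq_bigr => s _.
  by rewrite /b [(4 + _) *: _]scalerDl addrAC addrA.
have [rs rs_gt0 p_rs] : exists2 rs, all (> 0) rs &
    p = \prod_(r <- rs) (1 + r *: 'X).
  rewrite prodE; apply: prod_linear_factors => s.
  (* [cos >= -1] gives [b s >= 4 - 2 = 2]. *)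
  have := cos_geN1 (2 * s%:R * pi / (n + 2)%:R : R); rewrite /b; set c := cos _.
  lra.
have tp2p : tp2_poly p by rewrite p_rs; exact: tp2_poly_prod.
have p0 : p`_0 = 1.
  rewrite -horner_coef0 p_rs horner_prod big1 // => r _.
  by rewrite !(hornerD, hornerZ, hornerX, hornerC) mulr0 addr0.
split; first apply: palindromic_symmetric.
- by rewrite p0 oner_neq0.
- by rewrite prodE; exact: palindromic_prod.
split; first by rewrite p_rs; exact: only_real_zeros_prod.
by split; [exact: tp2_log_concave|apply: tp2_unimodal; rewrite ?p0].
Qed.
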